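(* For all $\mu,\nu\in\{\downarrow,\uparrow\}$ and all $0\le i,j\le D$: (i) $\overline{E^{\mu\nu}_{i,j}}=E^{\mu\nu}_{i,j}$ (the matrix $E^{\mu\nu}_{i,j}$ is real); (ii) $(E^{\downarrow\downarrow}_{i,j})^t=E^{\uparrow\uparrow}_{D-i,D-j}$; (iii) $(E^{\downarrow\uparrow}_{i,j})^t=E^{\uparrow\downarrow}_{D-i,D-j}$.
   Context: Let $\Gamma=(X,R)$ be a finite, undirected, connected graph without loops or multiple edges, with path-length distance $\partial$ and diameter $D\ge 3$, and assume $\Gamma$ is distance-regular. Let $\mathrm{Mat}_X(\mathbb C)$ be the algebra of complex matrices with rows and columns indexed by $X$, and let $V=\mathbb C X$ be the space of complex column vectors indexed by $X$ (the standard module), with Hermitian form $\langle u,v\rangle=u^t\overline v$. Let $E_0,\dots,E_D$ be the primitive idempotents of the Bose–Mesner algebra of $\Gamma$ (the algebra spanned by the distance matrices), ordered so that $\Gamma$ is $Q$-polynomial with respect to $E_0,\dots,E_D$. Fix a vertex $x\in X$, and for $0\le i\le D$ let $E^*_i$ be the diagonal matrix in $\mathrm{Mat}_X(\mathbb C)$ whose $(y,y)$-entry is $1$ if $\partial(x,y)=i$ and $0$ otherwise. For $-1\le i,j\le D$ define $V^{\downarrow\downarrow}_{i,j}=(E^*_0V+\dots+E^*_iV)\cap(E_0V+\dots+E_jV)$, $V^{\uparrow\downarrow}_{i,j}=(E^*_DV+\dots+E^*_{D-i}V)\cap(E_0V+\dots+E_jV)$, $V^{\downarrow\uparrow}_{i,j}=(E^*_0V+\dots+E^*_iV)\cap(E_DV+\dots+E_{D-j}V)$,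 $V^{\uparrow\uparrow}_{i,j}=(E^*_DV+\dots+E^*_{D-i}V)\cap(E_DV+\dots+E_{D-j}V)$, each interpreted as $0$ if $i=-1$ or $j=-1$. For $\mu,\nu\in\{\downarrow,\uparrow\}$ and $0\le i,j\le D$ let $\tilde V^{\mu\nu}_{i,j}$ be the orthogonal complement (with respect to $\langle\,,\rangle$) of $V^{\mu\nu}_{i-1,j}+V^{\mu\nu}_{i,j-1}$ inside $V^{\mu\nu}_{i,j}$. It is known that $V=\sum_{i=0}^D\sum_{j=0}^D\tilde V^{\mu\nu}_{i,j}$ is a direct sum (the $(\mu,\nu)$-split decomposition). Let $E^{\mu\nu}_{i,j}\in\mathrm{Mat}_X(\mathbb C)$ be the projection onto $\tilde V^{\mu\nu}_{i,j}$ with respect to this decomposition: it acts as the identity on $\tilde V^{\mu\nu}_{i,j}$ and as $0$ on $\tilde V^{\mu\nu}_{r,s}$ for $(r,s)\ne(i,j)$. *)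

(* Defs.v *)
From mathcomp Require Import all_boot all_order all_algebra.
From mathcomp Require Import zify.
From mathcomp Require Export reals complex.

Set Implicit Arguments.
Unset Strict Implicit.
Unset Printing Implicit Defensive.

Import Order.TTheory GRing.Theory Num.Theory.
Local Open Scope ring_scope.

Section Graph.
Variables (X : finType) (e : rel X).

Definition walk (n : nat) (x y : X) : bool :=
  [exists p : n.-tuple X, path e x p && (last x p == y)].

(* Least length of a walk from x to y.  A shortest walk visits no vertex twice,
   so its length is less than #|X|; the value is #|X| if y is unreachable. *)
Definition gdist (x y : X) : nat := find (fun n => walk n x y) (iota 0 #|X|).

Definition diameter : nat := \max_(p : X * X) gdist p.1 p.2.

Definition gconnected : Prop := forall x y : X, connect e x y.

Definition distance_regular : Prop :=
  exists p : nat -> nat -> nat -> nat, forall (h i j : nat) (x y : X),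
    gdist x y = h -> #|[set z | (gdist x z == i) && (gdist z y == j)]| = p h i j.

End Graph.

(* Matrices with rows and columns indexed by X are elements of 'M_#|X|, the
   index a : 'I_#|X| standing for the vertex enum_val a. *)
Section BoseMesner.
Variables (C : numClosedFieldType) (X : finType) (e : rel X) (D : nat).
Local Notation Mat := 'M[C]_#|X|.

Definition distance_mx (i : nat) : Mat :=
  \matrix_(a, b) (gdist e (enum_val a) (enum_val b) == i)%:R.

Definition bose_mesner : {vspace Mat} :=
  <<[seq distance_mx (i : 'I_D.+1) | i <- enum 'I_D.+1]>>%VS.

Definition primitive_idempotent (M : {vspace Mat}) (E : Mat) : Prop :=
  [/\ E \in M, E != 0, E *m E = E &
      forall F, F \in M -> F *m F = F -> F *m E = F -> E *m F = F ->
        F = 0 \/ F = E].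

Definition primitive_idempotents (E : 'I_D.+1 -> Mat) : Prop :=
  injective E /\
  forall F, primitive_idempotent bose_mesner F <-> exists i, F = E i.

(* q h i j is the Krein parameter q^h_{ij}; map2_mx *%R is the entrywise
   (Hadamard) product. *)
Definition krein_parameters (E : 'I_D.+1 -> Mat)
    (q : 'I_D.+1 -> 'I_D.+1 -> 'I_D.+1 -> C) : Prop :=
  forall i j,
    map2_mx *%R (E i) (E j) = (#|X|%:R)^-1 *: \sum_h q h i j *: E h.

Definition Q_polynomial (E : 'I_D.+1 -> Mat) : Prop :=
  E ord0 = const_mx (#|X|%:R)^-1 /\
  exists q, krein_parameters E q /\
    forall h i j : 'I_D.+1,
      ([|| i + j < h, h + j < i | h + i < j]%N -> q h i j = 0) /\
      ([|| h == i + j :> nat, i == h + j :> nat | j == h + i :> nat]%N ->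
        q h i j != 0).

Definition dual_idempotent (x : X) (i : nat) : Mat :=
  \matrix_(a, b) ((a == b) && (gdist e x (enum_val a) == i))%:R.

End BoseMesner.

Section Hermitian.
Variables (C : numClosedFieldType) (n : nat).
Local Notation V := 'cV[C]_n.

Definition hdot (u v : V) : C := (u^T *m map_mx Num.conj v) 0 0.

Definition orthov (W : {vspace V}) : {vspace V} :=
  lker (linfun (mulmx
    (\matrix_(k < \dim W, a < n) Num.conj ((vbasis W)`_k a 0)))).

Lemma mem_orthov (W : {vspace V}) (v : V) :
  v \in orthov W <-> forall w, w \in W -> hdot v w = 0.
Proof.
rewrite memv_ker lfunE /=.
have hE w : hdot v w = \sum_a v a 0 * Num.conj (w a 0).
  by rewrite /hdot mxE; apply: eq_bigr => a _; rewrite !mxE.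
split=> [/eqP h w wW | h].
  have h' (k : 'I_(\dim W)) : hdot v (vbasis W)`_k = 0.
    move/colP/(_ k): h; rewrite !mxE hE => hk; rewrite -[RHS]hk.
    by apply: eq_bigr => a _; rewrite mxE mulrC.
  rewrite (coord_vbasis wW) hE.
  under eq_bigr => a _ do rewrite summxE rmorph_sum mulr_sumr.
  rewrite exchange_big big1 //= => k _.
  under eq_bigr => a _ do rewrite mxE rmorphM mulrCA.
  by rewrite -mulr_sumr -hE h' mulr0.
apply/eqP/colP => k; rewrite !mxE -[RHS](h (vbasis W)`_k); last first.
  by apply: vbasis_mem; rewrite mem_nth // size_tuple.
by rewrite hE; apply: eq_bigr => a _; rewrite mxE mulrC.
Qed.

Lemma capv_orthov (W : {vspace V}) : (W :&: orthov W)%VS = 0%VS.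
Proof.
apply/eqP; rewrite -subv0; apply/subvP => v /memv_capP[vW /mem_orthov/(_ _ vW)].
rewrite memv0 /hdot mxE => /eqP; rewrite psumr_eq0 => [/allP h|a _]; last first.
  by rewrite !mxE mul_conjC_ge0.
apply/eqP/colP => a; apply/eqP.
have := h a (mem_index_enum _); rewrite !mxE /=.
by rewrite mul_conjC_eq0.
Qed.

End Hermitian.

Inductive direction := Down | Up.

Section Split.
Variables (C : numClosedFieldType) (n D : nat).
Local Notation V := 'cV[C]_n.

Definition colspace (A : 'M[C]_n) : {vspace V} :=
  limg (linfun (mulmx A : V -> V)).

(* Down: F_0 V + ... + F_i V;  Up: F_D V + ... + F_{D-i} V.
   The index i is an integer, and the sum is empty for i = -1. *)
Definition flag (F : 'I_D.+1 -> 'M[C]_n) (mu : direction) (i : int) :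
    {vspace V} :=
  match mu with
  | Down => (\sum_(k < D.+1 | (k%:Z <= i)%R) colspace (F k))%VS
  | Up => (\sum_(k < D.+1 | (D%:Z - i <= k%:Z)%R) colspace (F k))%VS
  end.

(* Es is the sequence of dual idempotents, E that of primitive idempotents. *)
Variables (Es E : 'I_D.+1 -> 'M[C]_n) (mu nu : direction).

Definition split_space (i j : int) : {vspace V} :=
  (flag Es mu i :&: flag E nu j)%VS.

Definition split_tilde (i j : int) : {vspace V} :=
  (split_space i j :&:
     orthov (split_space (i - 1) j + split_space i (j - 1)))%VS.

Definition split_decomposition : {vspace V} :=
  (\sum_(p : 'I_D.+1 * 'I_D.+1) split_tilde (p.1 : nat)%:Z (p.2 : nat)%:Z)%VS.

(* The matrix of the projection onto the (i, j) summand.  sumv_pi is the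
   projection along the other summands only if the sum is direct,
   which is split_decomposition_direct; see also split_proj_tilde. *)
Definition split_proj (i j : 'I_D.+1) : 'M[C]_n :=
  \matrix_(a, b) sumv_pi split_decomposition (i, j) (delta_mx b 0) a 0.

Lemma split_projE i j (v : V) :
  split_proj i j *m v = sumv_pi split_decomposition (i, j) v.
Proof.
rewrite {2}(matrix_sum_delta v).
under eq_bigr => b _ do rewrite big_ord1.
rewrite linear_sum; apply/colP => a; rewrite !mxE summxE.
by apply: eq_bigr => b _; rewrite linearZ !mxE mulrC.
Qed.

Lemma flagS F d (i j : int) : i <= j -> (flag F d i <= flag F d j)%VS.
Proof.
move=> ij; case: d; apply/subv_sumP => k hk; apply: (sumv_sup k) => //; lia.
Qed.

Lemma split_decomposition_direct : directv split_decomposition.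
Proof.
apply/directv_sum_independent => u uT su0.
suff h m : forall p : 'I_D.+1 * 'I_D.+1,
    (D.+1 * D.+1 - (p.1 * D.+1 + p.2) <= m)%N -> u p = 0.
  by move=> p _; apply: (h _ p (leqnn _)).
elim: m => [|m IH] [i j] /= hm.
  by have := ltn_ord i; have := ltn_ord j; nia.
have := uT (i, j) isT; rewrite /split_tilde => /memv_capP[uV uO].
set W := (_ + _)%VS in uO.
suff uW : u (i, j) \in W.
  by apply/eqP; rewrite -memv0 -(capv_orthov W); apply/memv_capP.
have up (p : 'I_D.+1 * 'I_D.+1) :
    u p \in flag Es mu (p.1 : nat)%:Z /\ u p \in flag E nu (p.2 : nat)%:Z.
  by have /memv_capP[/memv_capP[]] := uT p isT.
have gt0 (p : 'I_D.+1 * 'I_D.+1) :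
    (i < p.1)%N || ((i == p.1) && (j < p.2)%N) -> u p = 0.
  move=> hp; apply: IH; have := ltn_ord p.1; have := ltn_ord p.2.
  have := ltn_ord j; case/orP: hp => [|/andP[/eqP<-]]; nia.
have lt0 (p : 'I_D.+1 * 'I_D.+1) : p != (i, j) -> u p != 0 ->
    (p.1 < i)%N || ((p.1 == i) && (p.2 < j)%N).
  case: p => r s /= nij; apply: contraNT => hp; apply/eqP/gt0 => /=.
  move: nij hp; rewrite xpair_eqE -!val_eqE /=; lia.
have := su0; rewrite (bigD1 (i, j)) //=
  (bigID (fun p : 'I_D.+1 * 'I_D.+1 => p.1 < i)%N) /=.
set a := \sum_(p | _ && (_ < _)%N) _; set b := \sum_(p | _) _ => uab.
have aA : a \in flag Es mu ((i : nat)%:Z - 1).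
  apply: memv_suml => p /andP[_ pi]; have [pA _] := up p.
  by apply: (subvP (flagS _ _ _)) pA; lia.
have bP p : (p != (i, j)) && ~~ (p.1 < i)%N -> u p \in split_space i ((j : nat)%:Z - 1).
  case/andP=> pn pi; have [->|p0] := eqVneq (u p) 0; first exact: mem0v.
  have := lt0 p pn p0; rewrite (negPf pi) /= => /andP[/eqP p1 p2].
  apply/memv_capP; split; first by rewrite -p1; have [] := up p.
  by have [_ pB] := up p; apply: (subvP (flagS _ _ _)) pB; lia.
have bB : b \in split_space i ((j : nat)%:Z - 1) by apply: memv_suml.
have uE : u (i, j) = - a - b.
  by apply/eqP; rewrite -subr_eq0 opprB opprK (addrC b) uab.
rewrite uE; apply: memv_add; rewrite ?memvN //; apply/memv_capP; split=> //.
have -> : a = - u (i, j) - b by rewrite uE opprB opprK addrAC subrr add0r.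
rewrite memvB ?memvN //; first by have [] := up (i, j).
by have /memv_capP[_ bF] := bB; apply: (subvP (flagS _ _ _)) bF => /=; lia.
Qed.

Lemma split_proj_tilde (i j r s : 'I_D.+1) (v : V) :
  v \in split_tilde (r : nat)%:Z (s : nat)%:Z ->
  split_proj i j *m v = if (i, j) == (r, s) then v else 0.
Proof.
move=> vT; rewrite split_projE.
have vS : v \in split_decomposition.
  by apply: (subvP (sumv_sup (r, s) _ _)) vT.
have uT p (_ : true) : sumv_pi split_decomposition p v \in
    split_tilde (p.1 : nat)%:Z (p.2 : nat)%:Z by apply: memv_sum_pi.
pose w p := if p == (r, s) then v else 0.
have wT p (_ : true) : w p \in split_tilde (p.1 : nat)%:Z (p.2 : nat)%:Z.
  by rewrite /w; case: eqP => [->|_] //; apply: mem0v.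
have /directv_sum_unique/(_ _ _ uT wT) := split_decomposition_direct.
rewrite sumv_pi_sum // -big_mkcond big_pred1_eq eqxx.
by move/esym/forall_inP/(_ (i, j) isT)/eqP.
Qed.

End Split.

(* Main.v *)
(* Let N_m be the sum of the spaces V_{i,j} with i + j = m.  The adjacency
   matrix minus a suitable scalar sends V_{i,j} into V_{i+1,j-1}, the dual
   adjacency matrix minus a scalar sends it into V_{i-1,j+1}, so N_m is stable
   under the subconstituent algebra; hence so is its orthogonal complement.
   Stability gives two facts.  First, the (i,j) summand of the split
   decomposition is orthogonal to all of N_{i+j-1}.  Second, N_{m-1} and the
   space N'_{2D-m} built from the opposite flags are orthogonal and span
   everything: in a stable U orthogonal to both, the dimensions a_i and b_j of
   the traces of the two flags satisfy a_i + b_j <= dim U for i + j = m - 1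
   and a_i + b_j >= dim U for i + j = m - 2, so a_i is nonincreasing while
   running from 0 to dim U, and U = 0.  Consequently the (i,j) summand for one
   pair of flags is orthogonal to the (r,s) summand for the opposite pair
   unless i + r = j + s = D, which is the statement about transposes because
   the projections are real. *)

Require Import Defs.
From mathcomp Require Import all_boot all_order all_algebra.
From mathcomp Require Import reals complex.
From mathcomp Require Import zify ring.
From Stdlib Require Import Classical.
(* Imported again because all_algebra has another [orthov]. *)
Import Defs.

Set Implicit Arguments.
Unset Strict Implicit.
Unset Printing Implicit Defensive.

Import Order.TTheory GRing.Theory Num.Theory.
Local Open Scope ring_scope.

(** * Orthogonal complements and stable subspaces *)

Section HermitianForm.
Variables (C : numClosedFieldType) (n : nat).
Implicit Types (u v w : 'cV[C]_n) (W : {vspace 'cV[C]_n}) (M : 'M[C]_n).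

Lemma hdotE u v : hdot u v = \sum_a u a 0 * (v a 0)^*.
Proof. by rewrite /hdot mxE; apply: eq_bigr => a _; rewrite !mxE. Qed.

Lemma hdotDl u v w : hdot (u + v) w = hdot u w + hdot v w.
Proof. by rewrite /hdot linearD /= mulmxDl mxE. Qed.

Lemma hdotC u v : hdot v u = (hdot u v)^*.
Proof.
rewrite !hdotE rmorph_sum; apply: eq_bigr => a _.
by rewrite rmorphM /= conjCK mulrC.
Qed.

Lemma hdotDr u v w : hdot u (v + w) = hdot u v + hdot u w.
Proof. by rewrite hdotC hdotDl rmorphD /= -!hdotC. Qed.

Lemma hdot0l v : hdot 0 v = 0.
Proof. by rewrite /hdot trmx0 mul0mx mxE. Qed.

Lemma hdot0r v : hdot v 0 = 0.
Proof. by rewrite hdotC hdot0l conjC0. Qed.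

Lemma hdot_suml (I : finType) (P : pred I) (f : I -> 'cV[C]_n) w :
  hdot (\sum_(i | P i) f i) w = \sum_(i | P i) hdot (f i) w.
Proof.
by elim/big_rec2: _ => [|i a b _ <-]; rewrite ?hdot0l ?hdotDl.
Qed.

Lemma hdot_sumr (I : finType) (P : pred I) (f : I -> 'cV[C]_n) w :
  hdot w (\sum_(i | P i) f i) = \sum_(i | P i) hdot w (f i).
Proof.
by elim/big_rec2: _ => [|i a b _ <-]; rewrite ?hdot0r ?hdotDr.
Qed.

Lemma hdot_eq0 v : hdot v v = 0 -> v = 0.
Proof.
move=> vv0; have vW : v \in orthov <[v]>%VS.
  apply/mem_orthov => w /vlineP[k ->].
  rewrite hdotC hdotE; under eq_bigr => a _ do rewrite mxE -mulrA.
  by rewrite -mulr_sumr -hdotE vv0 mulr0 conjC0.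
by apply/eqP; rewrite -memv0 -(capv_orthov <[v]>%VS) memv_cap memv_line.
Qed.

Lemma hdot_mulmx M v w :
  map_mx Num.conj M = M -> hdot (M *m v) w = hdot v (M^T *m w).
Proof.
move=> Mreal; rewrite /hdot trmx_mul map_mxM /= mulmxA.
by rewrite (_ : map_mx _ M^T = M^T) // -[in RHS]Mreal; apply/matrixP => a b; rewrite !mxE.
Qed.

Lemma hdot_mulmx_eq (M N : 'M[C]_n) :
  (forall v w, hdot (M *m v) w = hdot (N *m v) w) -> M = N.
Proof.
move=> MN; apply/eqP; rewrite -subr_eq0; apply/eqP/matrixP => a b.
have /hdot_eq0 : hdot ((M - N) *m delta_mx b 0) ((M - N) *m delta_mx b 0) = 0.
  rewrite {1}mulmxBl hdotDl MN -hdotDl subrr hdot0l //.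
move/colP/(_ a); rewrite !mxE => <-.
rewrite (bigD1 b) //= big1 ?addr0 => [|c /negPf cb].
  by rewrite !mxE !eqxx mulr1.
by rewrite !mxE cb mulr0.
Qed.

(** Rank-nullity: [orthov W] is the kernel of a map into a space of dimension [\dim W], and it meets
    [W] trivially. *)
Lemma addv_orthov W : (W + orthov W)%VS = fullv.
Proof.
apply/eqP; rewrite eqEdim subvf /=.
rewrite dimv_disjoint_sum ?capv_orthov // /orthov.
set f := linfun _; rewrite -(limg_ker_dim f fullv) capfv addnC leq_add2r.
by apply: leq_trans (dimvS (subvf _)) _; rewrite dimvf /dim /= muln1.
Qed.

Lemma orthov_dec W v :
  exists a b, [/\ a \in W, b \in orthov W & v = a + b].
Proof.
have : v \in (W + orthov W)%VS by rewrite addv_orthov memvf.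
by case/memv_addP=> a aW [b bW ->]; exists a, b.
Qed.

Definition stable M W := forall v, v \in W -> M *m v \in W.

Lemma stable_add M W1 W2 : stable M W1 -> stable M W2 -> stable M (W1 + W2)%VS.
Proof.
move=> s1 s2 _ /memv_addP[a aW [b bW ->]].
by rewrite mulmxDr memv_add ?s1 ?s2.
Qed.

Lemma stable_orthov M W : M^T = M -> map_mx Num.conj M = M ->
  stable M W -> stable M (orthov W).
Proof.
move=> Msym Mreal MW v /mem_orthov vW; apply/mem_orthov => w wW.
by rewrite hdot_mulmx // Msym vW // MW.
Qed.

End HermitianForm.

(** * Index ranges and flags of a resolution of the identity *)

Definition opposite mu := if mu is Down then Up else Down.

Lemma oppositeK : involutive opposite.
Proof. by case. Qed.

(** One predicate for both summation conditions of [flag], so that the two directions share their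
    proofs. *)
Definition in_range D mu (i : int) (k : 'I_D.+1) : bool :=
  match mu with Down => k%:Z <= i | Up => D%:Z - i <= k%:Z end.

(** For [-1 <= i <= D] a range has [i + 1] indices, so its complement, counted from the other end,
    has bound [D - 1 - i]. *)
Lemma in_range_opposite D mu i (k : 'I_D.+1) :
  in_range (opposite mu) (D%:Z - 1 - i) k = ~~ in_range mu i k.
Proof. by case: mu => /=; lia. Qed.

Lemma in_rangeS D mu i j (k : 'I_D.+1) :
  i <= j -> in_range mu i k -> in_range mu j k.
Proof. by case: mu => /=; lia. Qed.

Lemma in_range_neg D mu i (k : 'I_D.+1) : i < 0 -> in_range mu i k = false.
Proof. by have := ltn_ord k; case: mu => /=; lia. Qed.

Lemma in_range_full D mu i (k : 'I_D.+1) : D%:Z <= i -> in_range mu i k.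
Proof. by have := ltn_ord k; case: mu => /=; lia. Qed.

Lemma in_range_jump D mu i (k l : 'I_D.+1) :
  in_range mu i l -> ~~ in_range mu (i + 1) k -> (k.+1 < l)%N || (l.+1 < k)%N.
Proof. by case: mu => /=; lia. Qed.

(** At most one index lies in the range for [i] but not in that for [i - 1]; [t] is the value of
    [th] there. *)
Lemma in_range_top (T : nmodType) D mu i (th : 'I_D.+1 -> T) :
  exists t, forall k, in_range mu i k -> ~~ in_range mu (i - 1) k -> th k = t.
Proof.
have [/existsP[l /andP[l1 l2]]|nex] :=
    boolP [exists l : 'I_D.+1, in_range mu i l && ~~ in_range mu (i - 1) l].
  exists (th l) => k k1 k2; congr th; apply: val_inj => /=.
  by move: l1 l2 k1 k2; case: mu => /=; lia.
(* There is no such index, so any value serves. *)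
exists 0 => k k1 k2; case/negP: nex; apply/existsP; exists k; exact/andP.
Qed.

Section Resolution.
Variables (C : numClosedFieldType) (n D : nat).
Local Notation V := 'cV[C]_n.

(** Both the primitive and the dual idempotents are of this kind, so the two flags can be treated
    symmetrically. *)
Record resolution (F : 'I_D.+1 -> 'M[C]_n) : Prop := Resolution {
  res_sym : forall k, (F k)^T = F k;
  res_real : forall k, map_mx Num.conj (F k) = F k;
  res_mul : forall k l, F k *m F l = if k == l then F k else 0;
  res_sum : \sum_k F k = 1%:M }.

Variables (F : 'I_D.+1 -> 'M[C]_n).
Hypothesis resF : resolution F.

Lemma res_dec (v : V) : v = \sum_k F k *m v.
Proof. by rewrite -mulmx_suml (res_sum resF) mul1mx. Qed.

Lemma res_mulA k l (v : V) : F k *m (F l *m v) = if k == l then F k *m v else 0.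
Proof. by rewrite mulmxA (res_mul resF); case: eqP => // _; rewrite mul0mx. Qed.

Lemma res_hdot k (v w : V) : hdot (F k *m v) w = hdot v (F k *m w).
Proof. by rewrite (hdot_mulmx _ _ (res_real resF k)) (res_sym resF). Qed.

Lemma mem_flag mu i (v : V) :
  v \in flag F mu i <-> (forall k, ~~ in_range mu i k -> F k *m v = 0).
Proof.
have -> : flag F mu i = (\sum_(k | in_range mu i k) colspace (F k))%VS.
  by case: mu.
split=> [/memv_sumP[w wF ->] k ki|h].
  rewrite mulmx_sumr big1 // => l li.
  have /memv_imgP[u _ ->] := wF l li; rewrite lfunE /= res_mulA.
  by case: eqP ki => // ->; rewrite li.
rewrite (res_dec v) (bigID (in_range mu i)) /= [X in _ + X]big1 // addr0.
apply: memv_suml => k ki; apply: (subvP (sumv_sup k ki (subvv _))).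
by apply/memv_imgP; exists v; rewrite ?memvf ?lfunE.
Qed.

Lemma flag_res mu i (k : 'I_D.+1) (v : V) :
  in_range mu i k -> F k *m v \in flag F mu i.
Proof.
by move=> ki; apply/mem_flag => l; rewrite res_mulA; case: eqP => // ->; rewrite ki.
Qed.

(** For [i + r < D] the two index ranges are disjoint, and distinct components are orthogonal. *)
Lemma hdot_flag mu i r (v w : V) : i + r < D%:Z ->
  v \in flag F mu i -> w \in flag F (opposite mu) r -> hdot v w = 0.
Proof.
move=> irD /mem_flag vF /mem_flag wF; rewrite (res_dec v) hdot_suml big1 // => k _.
have [ki|ki] := boolP (in_range mu i k); last by rewrite vF ?hdot0l.
rewrite res_hdot wF ?hdot0r // -in_range_opposite oppositeK.
by apply: in_rangeS ki; lia.
Qed.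

(** A stable [U] contains the components of its vectors; those inside the range and those outside it
    lie in complementary flags. *)
Lemma res_capv_dim (U : {vspace V}) mu i : (forall k, stable (F k) U) ->
  (\dim (U :&: flag F mu i) + \dim (U :&: flag F (opposite mu) (D%:Z - 1 - i))
    = \dim U)%N.
Proof.
move=> FU; rewrite -dimv_disjoint_sum.
  congr (\dim _); apply/eqP; rewrite eqEsubv subv_add !capvSl /=.
  apply/subvP => u uU; rewrite (res_dec u) (bigID (in_range mu i)) /=.
  apply: memv_add; apply: memv_suml => k ki; rewrite memv_cap FU //=;
    by apply: flag_res; rewrite ?in_range_opposite.
apply/eqP; rewrite -subv0; apply/subvP => v; rewrite !memv_cap => /andP[/andP[_ vi] /andP[_ vo]].
rewrite memv0; apply/eqP/hdot_eq0; apply: hdot_flag vi vo; lia.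
Qed.

(* [T] is diagonal on the ranges of the [F k]; subtracting the eigenvalue of
   the last of them lowers the flag. *)
Lemma flag_lower mu i (T : 'M[C]_n) (th : 'I_D.+1 -> C) :
  T = \sum_k th k *: F k ->
  exists t, forall v, v \in flag F mu i -> T *m v - t *: v \in flag F mu (i - 1).
Proof.
move=> TE; have [t tP] := in_range_top mu i th; exists t => v /mem_flag vF.
have FT k : F k *m (T *m v) = th k *: (F k *m v).
  rewrite TE mulmx_suml mulmx_sumr (bigD1 k) //= big1 ?addr0 => [|l lk].
    by rewrite -scalemxAl -scalemxAr res_mulA eqxx.
  by rewrite -scalemxAl -scalemxAr res_mulA eq_sym (negPf lk) scaler0.
apply/mem_flag => k ki; rewrite mulmxBr FT -scalemxAr -scalerBl.
have [kj|kj] := boolP (in_range mu i k); last by rewrite vF ?scaler0.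
by rewrite (tP k) // subrr scale0r.
Qed.

(** Tridiagonality moves a component by at most one index. The term [t *: v] is harmless and matches
    the form of [flag_lower]. *)
Lemma flag_raise mu i (T : 'M[C]_n) t :
  (forall k l : 'I_D.+1, (k.+1 < l)%N || (l.+1 < k)%N -> F k *m T *m F l = 0) ->
  forall v, v \in flag F mu i -> T *m v - t *: v \in flag F mu (i + 1).
Proof.
move=> tri v /mem_flag vF; apply/mem_flag => k ki; rewrite mulmxBr.
rewrite -scalemxAr [F k *m v]vF ?scaler0 ?subr0; last first.
  by apply: contra ki; apply: in_rangeS; lia.
rewrite [v]res_dec !mulmx_sumr big1 // => l _.
have [li|li] := boolP (in_range mu i l); last by rewrite vF ?mulmx0.
by rewrite !mulmxA tri ?mul0mx // (in_range_jump li).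
Qed.

Lemma flag_conj mu i (v : V) :
  v \in flag F mu i -> map_mx Num.conj v \in flag F mu i.
Proof.
move/mem_flag=> vF; apply/mem_flag => k ki.
by rewrite -(res_real resF) -map_mxM vF // map_mx0.
Qed.

End Resolution.

(** * The split decomposition of a pair of flags *)

Section SplitTilde.
Variables (C : numClosedFieldType) (n D : nat).
Local Notation V := 'cV[C]_n.
Variables (F G : 'I_D.+1 -> 'M[C]_n).
Hypotheses (resF : resolution F) (resG : resolution G).

Lemma split_spaceS mu nu i j i' j' : i <= i' -> j <= j' ->
  (split_space F G mu nu i j <= split_space F G mu nu i' j')%VS.
Proof. by move=> ii jj; apply: capvS; apply: flagS. Qed.

Lemma split_space_neg mu nu i j : i < 0 -> split_space F G mu nu i j = 0%VS.
Proof.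
move=> i0; apply/eqP; rewrite -subv0; apply/subvP => v /memv_capP[/(mem_flag resF) vF _].
by rewrite memv0 (res_dec resF v) big1 // => k _; rewrite vF ?in_range_neg.
Qed.

Lemma split_space_clamp mu nu i j :
  (split_space F G mu nu i j <= split_space F G mu nu D%:Z j)%VS.
Proof.
apply/subvP => v /memv_capP[_ vG]; apply/memv_capP; split => //.
by apply/(mem_flag resF) => k; rewrite in_range_full.
Qed.

(** Split orthogonally along the sum of the two smaller spaces; the other part stays in the split
    space, which contains that sum. *)
Lemma split_space_tilde mu nu i j :
  (split_space F G mu nu i j <= split_tilde F G mu nu i j
    + (split_space F G mu nu (i - 1) j + split_space F G mu nu i (j - 1)))%VS.
Proof.
apply/subvP => v vV; set W := (split_space _ _ _ _ (i - 1) j + _)%VS.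
have [a [b [aW bW vE]]] := orthov_dec W v; rewrite vE addrC memv_add //.
apply/memv_capP; split=> //; have -> : b = v - a by rewrite vE addrC addKr.
apply: memvB => //; apply: (subvP _ _ aW).
by rewrite subv_add !split_spaceS //; lia.
Qed.

Lemma split_space_neg_r mu nu i j : j < 0 -> split_space F G mu nu i j = 0%VS.
Proof.
move=> j0; apply/eqP; rewrite -subv0; apply/subvP => v /memv_capP[_ /(mem_flag resG) vG].
by rewrite memv0 (res_dec resG v) big1 // => k _; rewrite vG ?in_range_neg.
Qed.

(** Induction on [i + j] peels off one summand at a time; with bounds [D] both flags are the whole
    space. *)
Lemma split_decomposition_full mu nu : split_decomposition F G mu nu = fullv.
Proof.
have sub m : forall i j : int, i <= D%:Z -> j <= D%:Z -> i + j < m%:Z ->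
    (split_space F G mu nu i j <= split_decomposition F G mu nu)%VS.
  elim: m => [|m IH] i j iD jD ijm.
    by rewrite (_ : split_space _ _ _ _ _ _ = 0%VS) ?sub0v //;
       have [i0|i0] := ltrP i 0; [apply: split_space_neg|apply: split_space_neg_r; lia].
  have [i0|i0] := ltrP i 0; first by rewrite split_space_neg ?sub0v.
  have [j0|j0] := ltrP j 0; first by rewrite split_space_neg_r ?sub0v.
  apply: subv_trans (split_space_tilde _ _ _ _) _.
  rewrite !subv_add !IH ?andbT; try lia.
  have iD' : (`|i| < D.+1)%N by lia.
  have jD' : (`|j| < D.+1)%N by lia.
  apply: (sumv_sup (Ordinal iD', Ordinal jD')) => //=.
  by rewrite !gez0_abs.
apply/eqP; rewrite eqEsubv subvf /=.
apply: subv_trans (sub (D + D).+1 D%:Z D%:Z _ _ _); try lia.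
apply/subvP => v _; apply/memv_capP; split.
  by apply/(mem_flag resF) => k; rewrite in_range_full.
by apply/(mem_flag resG) => k; rewrite in_range_full.
Qed.

Lemma split_ind mu nu (P : V -> Prop) :
  P 0 -> (forall a b, P a -> P b -> P (a + b)) ->
  (forall (r s : 'I_D.+1) v, v \in split_tilde F G mu nu r s -> P v) ->
  forall v, P v.
Proof.
move=> P0 PD PT v; have : v \in split_decomposition F G mu nu.
  by rewrite split_decomposition_full memvf.
case/memv_sumP => u uT ->; elim/big_rec: _ => // p w _ Pw.
by apply: PD => //; apply: (PT p.1 p.2); apply: uT.
Qed.

(** The idempotents are real, so conjugation preserves the flags and each [split_tilde]; hence the
    projection and its conjugate agree on every summand. *)
Lemma split_proj_conj mu nu i j :
  map_mx Num.conj (split_proj F G mu nu i j) = split_proj F G mu nu i j.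
Proof.
set P := split_proj _ _ _ _ _ _; pose cj := map_mx (@Num.conj C).
have cjK m p : involutive (cj m p).
  by move=> M; apply/matrixP => a b; rewrite !mxE conjCK.
have space_conj r s v : v \in split_space F G mu nu r s ->
    cj _ _ v \in split_space F G mu nu r s.
  by move=> /memv_capP[vF vG]; rewrite memv_cap !flag_conj.
have tilde_conj r s v : v \in split_tilde F G mu nu r s ->
    cj _ _ v \in split_tilde F G mu nu r s.
  move=> /memv_capP[vV /mem_orthov vO]; apply/memv_capP; split; first exact: space_conj.
  apply/mem_orthov => w wW; rewrite -[w]cjK.
  have -> : hdot (cj _ _ v) (cj _ _ (cj _ _ w)) = (hdot v (cj _ _ w))^*.
    by rewrite !hdotE rmorph_sum; apply: eq_bigr => a _; rewrite !mxE rmorphM.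
  rewrite vO ?conjC0 //; have /memv_addP[a aW [b bW ->]] := wW.
  by rewrite /cj map_mxD memv_add ?space_conj.
apply: hdot_mulmx_eq => v w; congr (hdot _ w); move: v.
apply: (@split_ind mu nu); first by rewrite !mulmx0.
  by move=> a b; rewrite !mulmxDr => -> ->.
move=> r s v vT; rewrite (split_proj_tilde i j vT).
have -> : map_mx Num.conj P *m v = cj _ _ (P *m cj _ _ v).
  by rewrite [RHS]map_mxM; congr (_ *m _); exact/esym/cjK.
rewrite (split_proj_tilde i j (tilde_conj _ _ _ vT)).
by case: ifP => _; [exact: cjK | exact: map_mx0].
Qed.

Lemma split_proj_trmx mu nu :
  (forall (i j r s : 'I_D.+1) (v w : V),
     v \in split_tilde F G mu nu i j ->
     w \in split_tilde F G (opposite mu) (opposite nu) r s ->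
     (i, j) != (rev_ord r, rev_ord s) -> hdot v w = 0) ->
  forall i j, (split_proj F G mu nu i j)^T
    = split_proj F G (opposite mu) (opposite nu) (rev_ord i) (rev_ord j).
Proof.
move=> orth i j; have := split_proj_conj mu nu i j.
have := @split_proj_tilde C n D F G mu nu i j.
have := @split_proj_tilde C n D F G (opposite mu) (opposite nu) (rev_ord i) (rev_ord j).
move: (split_proj _ _ _ _ _ _) (split_proj _ _ _ _ _ _) => Q P QE PE Preal.
apply: hdot_mulmx_eq => v w; rewrite hdot_mulmx ?trmxK; last first.
  by rewrite -[in RHS]Preal; apply/matrixP => a b; rewrite !mxE.
move: v; apply: (@split_ind (opposite mu) (opposite nu)).
- by rewrite mulmx0 !hdot0l.
- by move=> v1 v2; rewrite mulmxDr !hdotDl => -> ->.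
move=> r s v vT; move: w; apply: (@split_ind mu nu).
- by rewrite mulmx0 !hdot0r.
- by move=> w1 w2; rewrite mulmxDr !hdotDr => -> ->.
move=> a b w wT; rewrite (PE _ _ _ wT) (QE _ _ _ vT).
(* Off the complementary pair both sides vanish by orthogonality; on it the two projections keep or
   kill their vectors together, as [rev_ord] is an involution. *)
have [ab|ab] := eqVneq (a, b) (rev_ord r, rev_ord s); last first.
  have o := orth _ _ _ _ _ _ wT vT ab.
  by do 2 case: ifP => _; rewrite ?hdot0l ?hdot0r // hdotC o conjC0.
case: ab wT => -> -> wT; 
rewrite !xpair_eqE !(can2_eq rev_ordK rev_ordK).
by case: ifP => _; rewrite ?hdot0l ?hdot0r.
Qed.

End SplitTilde.

(** * Orthogonality of opposite split decompositions *)

Section TridiagonalPair.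
Variables (C : numClosedFieldType) (n D : nat).
Local Notation V := 'cV[C]_n.
Variables (F G : 'I_D.+1 -> 'M[C]_n) (A B : 'M[C]_n).
Variables (th ph : 'I_D.+1 -> C).
Hypotheses (resF : resolution F) (resG : resolution G).
Hypotheses (AE : A = \sum_k th k *: G k) (BE : B = \sum_k ph k *: F k).
Hypothesis triA :
  forall k l : 'I_D.+1, (k.+1 < l)%N || (l.+1 < k)%N -> F k *m A *m F l = 0.
Hypothesis triB :
  forall k l : 'I_D.+1, (k.+1 < l)%N || (l.+1 < k)%N -> G k *m B *m G l = 0.
Hypothesis genA : forall U : {vspace V}, stable A U -> forall k, stable (G k) U.
Hypothesis genB : forall U : {vspace V}, stable B U -> forall k, stable (F k) U.

(** The second index may leave [[0, D]]: a negative one gives a zero term, and above [D] only the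
    first flag constrains. *)
Definition diag_space mu nu (m : int) : {vspace V} :=
  (\sum_(i < D.+1) split_space F G mu nu (i : nat)%:Z (m - (i : nat)%:Z))%VS.

Lemma split_space_diag mu nu i j m : i + j <= m ->
  (split_space F G mu nu i j <= diag_space mu nu m)%VS.
Proof.
move=> ijm; have [i0|i0] := ltrP i 0; first by rewrite split_space_neg ?sub0v.
(* An index [i] beyond [D] is replaced by [D], where the flag is already full. *)
have iD : (minn `|i|%N D < D.+1)%N by lia.
have [iD'|iD'] := lerP i D%:Z.
  by apply: (sumv_sup (Ordinal iD)) => //=; apply: split_spaceS; lia.
apply: subv_trans (split_space_clamp _ resF _ _ _ _) _.
by apply: (sumv_sup (Ordinal iD)) => //=; apply: split_spaceS; lia.
Qed.

Lemma diag_spaceS mu nu m m' : m <= m' ->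
  (diag_space mu nu m <= diag_space mu nu m')%VS.
Proof.
by move=> mm; apply/subv_sumP => i _; apply: split_space_diag; lia.
Qed.

(* A - t raises the first index and lowers the second one, so it preserves
   each antidiagonal sum. *)
Lemma diag_space_stableA mu nu m : stable A (diag_space mu nu m).
Proof.
move=> v /memv_sumP[u uV ->]; rewrite mulmx_sumr; apply: memv_suml => i _.
have /memv_capP[uF uG] := uV i isT.
have [t tP] := flag_lower resG nu (m - (i : nat)%:Z) AE.
have -> : A *m u i = (A *m u i - t *: u i) + t *: u i by rewrite subrK.
apply: memvD; last first.
  by apply: memvZ; apply: (subvP (split_space_diag _ _ _)) (uV i isT); lia.
apply: (subvP (@split_space_diag mu nu ((i : nat)%:Z + 1) (m - (i : nat)%:Z - 1) m _)); first lia.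
by rewrite memv_cap tP //= andbT; apply: flag_raise.
Qed.

Lemma diag_space_stableB mu nu m : stable B (diag_space mu nu m).
Proof.
move=> v /memv_sumP[u uV ->]; rewrite mulmx_sumr; apply: memv_suml => i _.
have /memv_capP[uF uG] := uV i isT.
have [t tP] := flag_lower resF mu (i : nat)%:Z BE.
have -> : B *m u i = (B *m u i - t *: u i) + t *: u i by rewrite subrK.
apply: memvD; last first.
  by apply: memvZ; apply: (subvP (split_space_diag _ _ _)) (uV i isT); lia.
apply: (subvP (@split_space_diag mu nu ((i : nat)%:Z - 1) (m - (i : nat)%:Z + 1) m _)); first lia.
by rewrite memv_cap tP //=; apply: flag_raise.
Qed.

Lemma diag_space_stable mu nu m k :
  stable (F k) (diag_space mu nu m) /\ stable (G k) (diag_space mu nu m).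
Proof.
by split; [apply: genB (@diag_space_stableB _ _ _) _
          |apply: genA (@diag_space_stableA _ _ _) _].
Qed.

(** Group the terms of [v] by first index below [i] or not. The first group [p] lies in the smaller
    [F]-flag and the second, [q], in the smaller [G]-flag; as [p + q = v], each also satisfies the
    other flag condition. *)
Lemma split_space_cap_diag mu nu i j v :
  v \in split_space F G mu nu i j -> v \in diag_space mu nu (i + j - 1) ->
  v \in (split_space F G mu nu (i - 1) j + split_space F G mu nu i (j - 1))%VS.
Proof.
move=> /memv_capP[vF vG] /memv_sumP[u uV vE].
pose p := \sum_(a < D.+1 | (a : nat)%:Z < i) u a.
pose q := \sum_(a < D.+1 | ~~ ((a : nat)%:Z < i)) u a.
have vpq : v = p + q by rewrite vE (bigID (fun a : 'I_D.+1 => (a : nat)%:Z < i)).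
have pF : p \in flag F mu (i - 1).
  apply: memv_suml => a ai; have /memv_capP[uF _] := uV a isT.
  by apply: (subvP (flagS _ _ _)) uF; lia.
have qG : q \in flag G nu (j - 1).
  apply: memv_suml => a ai; have /memv_capP[_ uG] := uV a isT.
  by apply: (subvP (flagS _ _ _)) uG; lia.
have pE : p = v - q by rewrite vpq addrK.
have qE : q = v - p by rewrite vpq addrC addKr.
rewrite vpq memv_add // memv_cap ?pF ?qG ?andbT /=.
  by rewrite pE memvB //; apply: (subvP (flagS _ _ _)) qG; lia.
by rewrite qE memvB //; apply: (subvP (flagS _ _ _)) pF; lia.
Qed.

(* The two components of v along diag_space and its complement stay in the
   same split space, because both summands are stable under F and G. *)
Lemma split_tilde_orth_diag mu nu i j v : v \in split_tilde F G mu nu i j ->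
  v \in orthov (diag_space mu nu (i + j - 1)).
Proof.
move=> /memv_capP[/memv_capP[vF vG] /mem_orthov vO].
set N := diag_space _ _ _; have [a [b [aN bN vE]]] := orthov_dec N v.
have Fstab k : stable (F k) N by have [] := diag_space_stable mu nu (i + j - 1) k.
have Gstab k : stable (G k) N by have [] := diag_space_stable mu nu (i + j - 1) k.
have comp (H : 'I_D.+1 -> 'M[C]_n) k : resolution H -> stable (H k) N ->
    H k *m v = 0 -> H k *m a = 0.
  move=> resH Hstab Hv.
  have aO : H k *m a \in orthov N.
    have -> : H k *m a = - (H k *m b).
      by apply/eqP; rewrite -addr_eq0 -mulmxDr -vE Hv.
    by rewrite memvN; apply: stable_orthov => //; [exact: res_sym|exact: res_real].
  by apply: hdot_eq0; move/mem_orthov: aO; apply; apply: Hstab.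
have aV : a \in split_space F G mu nu i j.
  apply/memv_capP; split.
    by apply/(mem_flag resF) => k ki; apply: comp => //; apply/(mem_flag resF): k ki.
  by apply/(mem_flag resG) => k ki; apply: comp => //; apply/(mem_flag resG): k ki.
(* [a] lies in the sum to which [v] is orthogonal, and [a] is orthogonal to [b], so
   [hdot a a = 0]. *)
have a0 : a = 0.
  apply: hdot_eq0; have := vO _ (split_space_cap_diag aV aN).
  by rewrite vE hdotDl (proj1 (mem_orthov _ _) bN) // addr0.
by rewrite vE a0 add0r.
Qed.

Lemma diag_space_add mu nu m :
  (diag_space mu nu m + diag_space (opposite mu) (opposite nu) (2 * D%:Z - 1 - m)
    = fullv)%VS.
Proof.
set N := diag_space mu nu m; set N' := diag_space _ _ _.
set U := orthov (N + N').
have UF k : stable (F k) U.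
  apply: stable_orthov; rewrite ?(res_sym resF) ?(res_real resF) //.
  by apply: stable_add; apply: (proj1 (diag_space_stable _ _ _ k)).
have UG k : stable (G k) U.
  apply: stable_orthov; rewrite ?(res_sym resG) ?(res_real resG) //.
  by apply: stable_add; apply: (proj2 (diag_space_stable _ _ _ k)).
have cap0 (W : {vspace V}) : (W <= N + N')%VS -> (U :&: W = 0)%VS.
  move=> WN; apply/eqP; rewrite -subv0 -(capv_orthov (N + N')) capvC.
  exact: capvS.
have dim_le i j mu' nu' : (split_space F G mu' nu' i j <= N + N')%VS ->
    (\dim (U :&: flag F mu' i) + \dim (U :&: flag G nu' j) <= \dim U)%N.
  move=> VN; rewrite -dimv_disjoint_sum; last first.
    apply/eqP; rewrite -subv0 -(cap0 _ VN) /split_space.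
    apply/subvP => v; rewrite !memv_cap.
    by move=> /andP[/andP[-> ->] /andP[_ ->]].
  by apply: dimvS; rewrite subv_add !capvSl.
pose a (i : int) := \dim (U :&: flag F mu i).
pose b (j : int) := \dim (U :&: flag G nu j).
have ab_le i : (a i + b (m - i)%R <= \dim U)%N.
  apply: dim_le; apply: subv_trans (addvSl _ _); apply: split_space_diag; lia.
(* Apply [dim_le] to the opposite flags, whose traces have the complementary dimensions
   [\dim U - a i] and [\dim U - b (m - 1 - i)]. *)
have ab_ge i : (\dim U <= a i + b (m - 1 - i)%R)%N.
  have := res_capv_dim resF mu i UF.
  have := res_capv_dim resG nu (m - 1 - i) UG.
  have -> : D%:Z - 1 - (m - 1 - i) = (2 * D%:Z - 1 - m) - (D%:Z - 1 - i) by lia.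
  have : (split_space F G (opposite mu) (opposite nu) (D%:Z - 1 - i)
      (2 * D%:Z - 1 - m - (D%:Z - 1 - i)) <= N + N')%VS.
    by apply: subv_trans (addvSr _ _); apply: split_space_diag; lia.
  by move/dim_le; rewrite /a /b; lia.
(* [ab_le] at [k + 1] and [ab_ge] at [k] involve the same value of [b]. *)
have aS k : (a (k + 1)%R <= a k)%N.
  by have := ab_le (k + 1); have := ab_ge k; rewrite (_ : m - (k + 1) = m - 1 - k); lia.
have a_le (k : nat) : (a k%:Z <= a (-1)%R)%N.
  elim: k => [|k IH]; first exact: (aS (-1)).
  by apply: leq_trans IH; rewrite -addn1 PoszD.
have aN : a (-1)%R = 0%N.
  apply/eqP; rewrite /a dimv_eq0 -subv0; apply/subvP => v /memv_capP[_ /(mem_flag resF) vF].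
  by rewrite memv0 (res_dec resF v) big1 // => k _; rewrite vF ?in_range_neg.
have aD : a D%:Z = \dim U.
  congr (\dim _); apply/capv_idPl/subvP => v _.
  by apply/(mem_flag resF) => k; rewrite in_range_full.
have /eqP U0 : \dim U == 0%N by rewrite -leqn0 -aD -aN a_le.
rewrite -[LHS]addv0 -(addv_orthov (N + N')); congr (_ + _)%VS.
by apply/esym/eqP; rewrite -dimv_eq0 U0.
Qed.

(** In each pair of terms, the first indices or the second ones add up to less than [D], so
    [hdot_flag] applies. *)
Lemma hdot_diag_space mu nu m m' v w : m + m' < 2 * D%:Z ->
  v \in diag_space mu nu m -> w \in diag_space (opposite mu) (opposite nu) m' ->
  hdot v w = 0.
Proof.
move=> mm /memv_sumP[u uV ->] /memv_sumP[t tV ->]; rewrite hdot_suml big1 // => i _.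
rewrite hdot_sumr big1 // => r _.
have /memv_capP[uF uG] := uV i isT; have /memv_capP[tF tG] := tV r isT.
have [ir|ir] := ltrP ((i : nat)%:Z + (r : nat)%:Z) D%:Z.
  exact: (hdot_flag resF ir uF tF).
by apply: (hdot_flag resG _ uG tG); lia.
Qed.

Lemma split_tilde_orth mu nu (i j r s : 'I_D.+1) (v w : V) :
  v \in split_tilde F G mu nu i j ->
  w \in split_tilde F G (opposite mu) (opposite nu) r s ->
  (i, j) != (rev_ord r, rev_ord s) -> hdot v w = 0.
Proof.
move=> vT wT; have /memv_capP[/memv_capP[vF vG] _] := vT.
have /memv_capP[/memv_capP[wF wG] _] := wT.
have [ir|ir] := ltrP ((i : nat)%:Z + (r : nat)%:Z) D%:Z.
  by rewrite (hdot_flag resF ir vF wF).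
have [js|js] := ltrP ((j : nat)%:Z + (s : nat)%:Z) D%:Z.
  by rewrite (hdot_flag resG js vG wG).
rewrite xpair_eqE -!val_eqE /= => ne.
(* Both index sums are at least [D], and they are not both equal to [D]. *)
have gt : 2 * D%:Z < (i : nat)%:Z + (j : nat)%:Z + ((r : nat)%:Z + (s : nat)%:Z).
  by have := ltn_ord r; have := ltn_ord s; lia.
have /mem_orthov vO := split_tilde_orth_diag vT.
have /mem_orthov wO := split_tilde_orth_diag wT.
set m := (i : nat)%:Z + (j : nat)%:Z - 1 in vO.
have : v \in (diag_space mu nu m
    + diag_space (opposite mu) (opposite nu) (2 * D%:Z - 1 - m))%VS.
  by rewrite diag_space_add memvf.
case/memv_addP=> a aN [b bN vE].
(* The indices of the two diagonal spaces add up to [2 * D - 1], so [a] is orthogonal to [b] as well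
   as to [v]; hence [v = b]. *)
have a0 : a = 0.
  apply: hdot_eq0; have := vO a aN; rewrite vE hdotDl.
  rewrite [hdot b a]hdotC (hdot_diag_space _ aN bN) ?conjC0 ?addr0 //; lia.
rewrite vE a0 add0r hdotC wO ?conjC0 //.
(* By [gt], [2 * D - 1 - m <= r + s - 1], and [w] is orthogonal to the diagonal space of index
   [r + s - 1]. *)
by apply: (subvP (diag_spaceS _ _ _)) bN; lia.
Qed.

Lemma tridiagonal_split_proj_trmx mu nu i j : (split_proj F G mu nu i j)^T
    = split_proj F G (opposite mu) (opposite nu) (rev_ord i) (rev_ord j).
Proof. apply: split_proj_trmx => //; exact: split_tilde_orth. Qed.

End TridiagonalPair.

(** * Distance in a connected graph *)

Section Distance.
Local Open Scope nat_scope.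
Variables (X : finType) (e : rel X).
Hypotheses (e_sym : symmetric e) (e_conn : gconnected e).
Implicit Types x y z : X.

Lemma walkP k x y : reflect
  (exists p, [/\ size p = k, path e x p & last x p = y]) (walk e k x y).
Proof.
apply: (iffP existsP) => [[p /andP[pp /eqP pl]]|[p [sp pp pl]]].
  by exists p; rewrite size_tuple.
by have /eqP tp := sp; exists (Tuple tp); rewrite pp pl /=.
Qed.

Lemma gdist_le k x y : walk e k x y -> gdist e x y <= k.
Proof.
move=> w; have [kX|kX] := ltnP k #|X|; last first.
  by apply: leq_trans (find_size _ _) _; rewrite size_iota.
rewrite leqNgt; apply/negP => /(before_find 0).
by rewrite nth_iota // add0n w.
Qed.

(** A path with distinct vertices has length less than [#|X|], so the bounded search in [gdist]
    succeeds. *)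
Lemma gdist_walk x y : walk e (gdist e x y) x y.
Proof.
have /connectP[p pp ->] := e_conn x y; have [q pq uq _] := shortenP pp.
have hw : has (fun k => walk e k x (last x q)) (iota 0 #|X|).
  apply/hasP; exists (size q); last by apply/walkP; exists q.
  by rewrite mem_iota /=; have := max_card (mem (x :: q)); rewrite (card_uniqP uq).
have := nth_find 0 hw; rewrite nth_iota ?add0n //.
by rewrite -[X in _ < X](size_iota 0) -has_find.
Qed.

Lemma gdist_eq0 x y : (gdist e x y == 0) = (x == y).
Proof.
apply/eqP/eqP => [d0|->].
  by have := gdist_walk x y; rewrite d0 => /walkP[[|? ?] [] // _ _ ->].
by apply/eqP; rewrite -leqn0; apply: gdist_le; apply/walkP; exists [::].
Qed.

Lemma gdist_sym x y : gdist e x y = gdist e y x.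
Proof.
suff le a b : gdist e a b <= gdist e b a by apply/eqP; rewrite eqn_leq !le.
apply: gdist_le; have /walkP[p [<- pp <-]] := gdist_walk b a; apply/walkP.
exists (rev (belast b p)); split; first by rewrite size_rev size_belast.
  by rewrite rev_path; apply: sub_path pp => u v; rewrite e_sym.
by case: p pp => //= c p _; rewrite rev_cons last_rcons.
Qed.

Lemma gdist_triangle x y z : gdist e x z <= gdist e x y + gdist e y z.
Proof.
apply: gdist_le; have /walkP[p [sp pp lp]] := gdist_walk x y.
have /walkP[q [sq pq lq]] := gdist_walk y z.
by apply/walkP; exists (p ++ q); rewrite size_cat cat_path last_cat sp sq pp lp.
Qed.

Lemma gdist_step x y k : gdist e x y = k.+1 ->
  exists z, gdist e x z = 1 /\ gdist e z y = k.
Proof.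
move=> dk; have := gdist_walk x y; rewrite dk => /walkP[[|z p] [] //= [sp] /andP[xz zp] lp].
have zy : gdist e z y <= k by apply: gdist_le; apply/walkP; exists p.
have xz1 : gdist e x z <= 1.
  by apply: gdist_le; apply/walkP; exists [:: z]; rewrite /= xz.
have := gdist_triangle x z y; rewrite dk => t; exists z; lia.
Qed.

Lemma gdist_diameter x y : gdist e x y <= diameter e.
Proof. exact: (@leq_bigmax_cond _ xpredT (fun p : X * X => gdist e p.1 p.2) (x, y)). Qed.

End Distance.

(** * Stability of a subspace along a recurrence *)

Section Stable.
Variables (C : numClosedFieldType) (n : nat) (U : {vspace 'cV[C]_n}).

Lemma stableZ c (T : 'M[C]_n) : stable T U -> stable (c *: T) U.
Proof. by move=> TU v vU; rewrite -scalemxAl memvZ ?TU. Qed.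

Lemma stableM (S T : 'M[C]_n) : stable S U -> stable T U -> stable (S *m T) U.
Proof. by move=> SU TU v vU; rewrite -mulmxA; apply/SU/TU. Qed.

Lemma stableB (S T : 'M[C]_n) : stable S U -> stable T U -> stable (S - T) U.
Proof. by move=> SU TU v vU; rewrite mulmxBl memvB ?SU ?TU. Qed.

Lemma stable_sum (I : finType) (P : pred I) (T : I -> 'M[C]_n) :
  (forall i, P i -> stable (T i) U) -> stable (\sum_(i | P i) T i) U.
Proof.
by move=> TU v vU; rewrite mulmx_suml; apply: memv_suml => i /TU; apply.
Qed.

(** Solving for the term of index [i + 1] expresses every [T i] through [T ord0] and [T o]. The
    conditions involve [T h] because intersection numbers are arbitrary at distances that no pair of
    vertices attains. *)
Lemma stable_recurrence D (T : 'I_D.+1 -> 'M[C]_n) (c : 'I_D.+1 -> 'I_D.+1 -> C) o :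
  stable (T ord0) U -> stable (T o) U ->
  (forall i : 'I_D.+1, T o *m T i = \sum_h c h i *: T h) ->
  (forall i h : 'I_D.+1, (i.+1 < h)%N -> c h i *: T h = 0) ->
  (forall i h : 'I_D.+1, h = i.+1 :> nat -> c h i != 0 \/ T h = 0) ->
  forall i, stable (T i) U.
Proof.
move=> T0 To TE Tfar Tnear.
suff st m : forall i : 'I_D.+1, (i <= m)%N -> stable (T i) U.
  by move=> i; apply: (st i).
elim: m => [|m IH] i; first by rewrite leqn0 => /eqP i0; rewrite (_ : i = ord0) //; apply: val_inj.
rewrite leq_eqVlt => /orP[/eqP im|]; last exact: IH.
have mD : (m < D.+1)%N by have := ltn_ord i; lia.
have [c0|->] := Tnear (Ordinal mD) i im; last first.
  by move=> v _; rewrite mul0mx mem0v.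
have -> : T i = (c i (Ordinal mD))^-1 *:
    (T o *m T (Ordinal mD) - \sum_(h : 'I_D.+1 | (h <= m)%N) c h (Ordinal mD) *: T h).
  rewrite TE (bigID (fun h : 'I_D.+1 => (h <= m)%N)) /= addrAC subrr add0r.
  rewrite (bigD1 i) /=; last by rewrite im ltnn.
  rewrite big1 ?addr0 ?scalerA ?mulVf ?scale1r // => h /andP[hm hi].
  apply: Tfar => /=; move: hi; rewrite -val_eqE /=; lia.
apply: stableZ; apply: stableB; first by apply: stableM => //; apply: IH.
by apply: stable_sum => h hm; apply: stableZ; apply: IH.
Qed.

End Stable.

Section Frobenius.
Variable C : numClosedFieldType.

(** The trace is the squared Frobenius norm. *)
Lemma trace_adjoint_eq0 n (T : 'M[C]_n) : \tr (T *m (map_mx Num.conj T)^T) = 0 -> T = 0.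
Proof.
move=> tr0; apply/matrixP => a b; rewrite mxE.
have pos i j : 0 <= T i j * (T i j)^* by rewrite mul_conjC_ge0.
move: tr0; rewrite /mxtrace.
under eq_bigr => i _ do (rewrite mxE; under eq_bigr => j _ do rewrite !mxE).
move/eqP; rewrite psumr_eq0 => [|i _]; last by apply: sumr_ge0.
move/allP/(_ a (mem_index_enum _)); rewrite psumr_eq0 => [|j _]; last exact: pos.
by move/allP/(_ b (mem_index_enum _)); rewrite mul_conjC_eq0 => /eqP.
Qed.

End Frobenius.

(** * The Bose-Mesner algebra and its primitive idempotents *)

Section BoseMesnerAlgebra.
Variables (C : numClosedFieldType) (X : finType) (e : rel X) (D : nat).
Hypotheses (e_sym : symmetric e) (e_conn : gconnected e).
Hypotheses (e_diam : diameter e = D) (e_dr : distance_regular e).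
Local Notation Mat := 'M[C]_#|X|.
Local Notation A := (distance_mx C e).
Local Notation M := (bose_mesner C e D).

Lemma mem_bose_mesner (T : Mat) :
  T \in M <-> exists c : 'I_D.+1 -> C, T = \sum_i c i *: A i.
Proof.
rewrite /bose_mesner span_def big_map big_enum /=; split=> [/memv_sumP[t tA ->]|[c ->]].
  have ex i : exists k, t i == k *: A i by have /vlineP[k ->] := tA i isT; exists k.
  by exists (fun i => xchoose (ex i)); apply: eq_bigr => i _; apply/eqP/(xchooseP (ex i)).
apply: memv_suml => i _; apply: (subvP (sumv_sup i _ (subvv _))) => //.
by apply: memvZ; apply: memv_line.
Qed.

Lemma distance_mx_mem (i : 'I_D.+1) : A i \in M.
Proof.
apply/mem_bose_mesner; exists (fun j => (j == i)%:R).
by rewrite (bigD1 i) //= eqxx scale1r big1 ?addr0 // => j /negPf->; rewrite scale0r.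
Qed.

Lemma distance_mxE i a b : A i a b = (gdist e (enum_val a) (enum_val b) == i)%:R.
Proof. by rewrite mxE. Qed.

Lemma distance_mx0 : A 0 = 1%:M.
Proof.
by apply/matrixP => a b; rewrite distance_mxE gdist_eq0 // (inj_eq enum_val_inj) mxE.
Qed.

Lemma gdist_lt x y : (gdist e x y < D.+1)%N.
Proof. by rewrite ltnS -e_diam gdist_diameter. Qed.

Lemma sum_gdist (f : 'I_D.+1 -> C) x y :
  \sum_i f i * (gdist e x y == i)%:R = f (Ordinal (gdist_lt x y)).
Proof.
rewrite (bigD1 (Ordinal (gdist_lt x y))) //= eqxx mulr1 big1 ?addr0 // => i.
by rewrite -val_eqE /= eq_sym => /negPf->; rewrite mulr0.
Qed.

Lemma distance_mx_mul : exists p : nat -> nat -> nat -> nat,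
  (forall h i j x y, gdist e x y = h ->
     #|[set z | (gdist e x z == i) && (gdist e z y == j)]| = p h i j) /\
  forall i j, A i *m A j = \sum_(h < D.+1) (p h i j)%:R *: A h.
Proof.
have [p pE] := e_dr; exists p; split=> // i j; apply/matrixP => a b.
rewrite mxE summxE; under [RHS]eq_bigr => h _ do rewrite mxE distance_mxE.
rewrite (sum_gdist (fun h => (p h i j)%:R)) /= -(pE _ _ _ _ _ (erefl _)).
rewrite cardsE -[X in _ = X%:R]sum1_card natr_sum.
rewrite [RHS](reindex (enum_val : 'I_#|X| -> X)); last exact: onW_bij (@enum_val_bij X).
rewrite [RHS]big_mkcond /=; apply: eq_bigr => c _; rewrite !distance_mxE unfold_in /=.
by do 2 case: eqP => _; rewrite ?mulr0 ?mul0r ?mulr1.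
Qed.

Lemma distance_mx_sym i : (A i)^T = A i.
Proof. by apply/matrixP => a b; rewrite mxE !distance_mxE gdist_sym. Qed.

Lemma bose_mesner_sym T : T \in M -> T^T = T.
Proof.
case/mem_bose_mesner=> c ->; rewrite linear_sum; apply: eq_bigr => i _.
by rewrite linearZ /= distance_mx_sym.
Qed.

Lemma distance_mx_conj i : map_mx Num.conj (A i) = A i.
Proof. by apply/matrixP => a b; rewrite !mxE conjC_nat. Qed.

Lemma bose_mesner_conj T : T \in M -> map_mx Num.conj T \in M.
Proof.
case/mem_bose_mesner=> c ->; apply/mem_bose_mesner; exists (fun i => (c i)^*).
by rewrite map_mx_sum; apply: eq_bigr => i _; rewrite map_mxZ distance_mx_conj.
Qed.

Lemma bose_mesner1 : 1%:M \in M.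
Proof.
by rewrite -distance_mx0 (distance_mx_mem ord0).
Qed.

Lemma bose_mesnerM S T : S \in M -> T \in M -> S *m T \in M.
Proof.
case/mem_bose_mesner=> c -> /mem_bose_mesner[d ->].
have [p [_ AA]] := distance_mx_mul.
rewrite mulmx_suml; apply: memv_suml => i _.
rewrite mulmx_sumr; apply: memv_suml => j _.
rewrite -scalemxAl -scalemxAr AA; do 2 apply: memvZ.
by apply: memv_suml => h _; apply: memvZ; apply: distance_mx_mem.
Qed.

(** Every element of the algebra is symmetric, products included, and transposition reverses a
    product. *)
Lemma bose_mesnerC S T : S \in M -> T \in M -> S *m T = T *m S.
Proof.
move=> SM TM; rewrite -[LHS]bose_mesner_sym ?bose_mesnerM //.
by rewrite trmx_mul !bose_mesner_sym.
Qed.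

Lemma dim_bose_mesner : (\dim M <= D.+1)%N.
Proof. by apply: leq_trans (dim_span _) _; rewrite size_map size_enum_ord. Qed.

Lemma bose_mesner_stable (o : 'I_D.+1) (U : {vspace 'cV[C]_#|X|}) T :
  o = 1%N :> nat -> T \in M -> stable (A o) U -> stable T U.
Proof.
move=> o1 /mem_bose_mesner[c ->] AU; apply: stable_sum => i _; apply: stableZ.
have [p [pE AA]] := distance_mx_mul.
apply: (@stable_recurrence _ _ U D (fun i => A i) (fun h i => (p h o i)%:R) o) => //.
- by move=> v; rewrite distance_mx0 mul1mx.
- move=> {}i h ih; apply/matrixP => a b; rewrite mxE distance_mxE [RHS]mxE.
  case: eqP => [dab|_]; last by rewrite mulr0.
  rewrite -(pE _ _ _ _ _ dab) (eq_card0 (A := _)) ?mul0r // => z; rewrite inE o1.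
  apply/negP => /andP[/eqP az /eqP zb].
  by have := gdist_triangle e_conn (enum_val a) z (enum_val b); lia.
(* If [p h o i = 0], a pair at distance [i + 1] would contradict [gdist_step], so the distance
   matrix is zero. *)
move=> {}i h ih; have [p0|] := eqVneq (p h o i) 0%N; last by rewrite -(pnatr_eq0 C) => ?; left.
right; apply/matrixP => a b; rewrite distance_mxE mxE.
case: eqP => // dab; have [z [az zb]] := gdist_step e_conn (etrans dab ih).
have := pE _ o i _ _ dab; rewrite p0 => /eqP; rewrite cards_eq0 => /eqP/setP/(_ z).
by rewrite !inE az zb o1 !eqxx.
Qed.

End BoseMesnerAlgebra.

Section PrimitiveIdempotents.
Variables (C : numClosedFieldType) (X : finType) (e : rel X) (D : nat).
Hypotheses (e_sym : symmetric e) (e_conn : gconnected e).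
Hypotheses (e_diam : diameter e = D) (e_dr : distance_regular e).
Local Notation Mat := 'M[C]_#|X|.
Local Notation M := (bose_mesner C e D).
Variable E : 'I_D.+1 -> Mat.
Hypothesis E_prim : primitive_idempotents e E.

Lemma prim_idem i : primitive_idempotent M (E i).
Proof. by have [_ EP] := E_prim; apply/EP; exists i. Qed.

Lemma prim_mem i : E i \in M.
Proof. by have [] := prim_idem i. Qed.

(** The product is an idempotent below both factors; by primitivity it is zero or equal to both. *)
Lemma prim_mul k l : E k *m E l = if k == l then E k else 0.
Proof.
have [kM k0 kk kP] := prim_idem k; have [lM l0 ll lP] := prim_idem l.
case: eqP => [<- //|kl]; pose F := E k *m E l.
have FC : F = E l *m E k by exact: (bose_mesnerC e_sym e_conn e_diam e_dr kM lM).
have Fk : E k *m F = F by rewrite /F mulmxA kk.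
have Fl : F *m E l = F by rewrite /F -mulmxA ll.
have FM : F \in M by apply: bose_mesnerM.
have FF : F *m F = F by rewrite {2}FC mulmxA Fl FC -mulmxA kk.
have [//|Ek] : F = 0 \/ F = E k.
  by apply: kP => //; rewrite {1}FC -mulmxA kk -FC.
have [//|El] : F = 0 \/ F = E l.
  by apply: lP => //; rewrite FC mulmxA ll -FC.
by case: kl; have [inj _] := E_prim; apply: inj; rewrite -Ek -El.
Qed.

(** Induction on the rank: a nonprimitive [Q] has a nonzero idempotent [F] strictly below it. *)
Lemma exists_prim_below Q : Q \in M -> Q != 0 -> Q *m Q = Q ->
  exists k, E k *m Q = E k.
Proof.
have [r] := ubnP (\rank Q); elim: r Q => // r IH Q rQ QM Q0 QQ.
have [/(proj2 E_prim)[k Qk]|nprim] := classic (primitive_idempotent M Q).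
  by exists k; rewrite -Qk.
have [F [FM FF FQ QF [F0 FnQ]]] : exists F, [/\ F \in M, F *m F = F, F *m Q = F,
    Q *m F = F & F != 0 /\ F != Q].
  apply: NNPP => nex; apply: nprim; split=> // F FM FF FQ QF.
  have [->|F0] := eqVneq F 0; first by left.
  have [->|FnQ] := eqVneq F Q; first by right.
  by case: nex; exists F.
have sFQ : (F <= Q)%MS by rewrite -FQ submxMl.
have [k kF] : exists k, E k *m F = E k.
  (* Equal ranks would give [Q = Z *m F], whence [F = Q *m F = Q]. *)
  apply: IH => //; apply: (@leq_trans (\rank Q)) => //; rewrite ltn_neqAle (mxrankS sFQ) andbT.
  rewrite (mxrank_leqif_sup sFQ); apply: contra FnQ => /submxP[Z QZ].
  by rewrite -QF QZ -mulmxA FF.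
by exists k; rewrite -kF -mulmxA FQ.
Qed.

(** Otherwise the idempotent [1 - P] would have some [E k] below it, yet [E k] annihilates
    [1 - P]. *)
Lemma prim_sum : \sum_k E k = 1%:M.
Proof.
pose P := \sum_k E k; have EP k : E k *m P = E k.
  rewrite mulmx_sumr (bigD1 k) //= prim_mul eqxx big1 ?addr0 // => l lk.
  by rewrite prim_mul eq_sym (negPf lk).
have PP : P *m P = P by rewrite {1}/P mulmx_suml; apply: eq_bigr => k _; apply: EP.
have PM : P \in M by apply: memv_suml => k _; apply: prim_mem.
have [/eqP|Q0] := eqVneq (1%:M - P) 0; first by rewrite subr_eq0 => /eqP.
have [||k] := @exists_prim_below (1%:M - P) _ Q0.
- by rewrite memvB // bose_mesner1.
- by rewrite mulmxBl mul1mx mulmxBr mulmx1 PP subrr subr0.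
rewrite mulmxBr mulmx1 EP subrr => /esym/eqP Ek0.
by have [_ /negP] := prim_idem k.
Qed.

(* The conjugate of E k is again primitive, and E k times it is nonzero. *)
Lemma prim_real k : map_mx Num.conj (E k) = E k.
Proof.
set cj := map_mx _; have cjK : involutive (cj : Mat -> Mat).
  by move=> T; apply/matrixP => a b; rewrite !mxE conjCK.
have cjM S T : cj (S *m T) = cj S *m cj T by exact: map_mxM.
have [kM k0 kk kP] := prim_idem k.
have : primitive_idempotent M (cj (E k)).
  split; first exact: bose_mesner_conj.
  - by apply: contra k0 => /eqP c0; rewrite -[E k]cjK c0 /cj map_mx0.
  - by rewrite -cjM kk.
  move=> F FM FF Fk kF.
  have FF' : cj F *m cj F = cj F by rewrite -cjM FF.
  have Fk' : cj F *m E k = cj F by rewrite -[E k]cjK -cjM Fk.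
  have kF' : E k *m cj F = cj F by rewrite -[E k]cjK -cjM kF.
  have [F0|FE] := kP _ (bose_mesner_conj FM) FF' Fk' kF'; [left|right].
    by rewrite -[F]cjK (F0 : cj F = 0) /cj map_mx0.
  by rewrite -(FE : cj F = _) cjK.
move/(proj2 E_prim) => [l cE].
have [kl|kl] := eqVneq k l; first by rewrite cE kl.
case/eqP: k0; apply: trace_adjoint_eq0; rewrite -/(cj (E k)) cE.
by rewrite (bose_mesner_sym _ _ (prim_mem l)) // prim_mul (negPf kl) linear0.
Qed.

Lemma prim_resolution : resolution E.
Proof.
split; [|exact: prim_real|exact: prim_mul|exact: prim_sum].
by move=> k; apply: (bose_mesner_sym _ _ (prim_mem k)).
Qed.

(** The [E k] are [D + 1] independent elements of a space of dimension at most [D + 1]. *)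
Lemma bose_mesner_prim T : T \in M -> exists c, T = \sum_k c k *: E k.
Proof.
move=> TM; pose B := [tuple E k | k < D.+1].
have BE (k : 'I_D.+1) : B`_k = E k by rewrite -tnth_nth tnth_mktuple.
have freeB : free B.
  apply/freeP => c c0 k; have := congr1 (mulmx (E k)) c0.
  rewrite mulmx0 mulmx_sumr (bigD1 k) //= big1 => [|l lk]; last first.
    by rewrite BE -scalemxAr prim_mul eq_sym (negPf lk) scaler0.
  rewrite addr0 BE -scalemxAr prim_mul eqxx => /eqP; rewrite scaler_eq0.
  by have [_ /negPf-> _ _] := prim_idem k; rewrite orbF => /eqP.
have sBM : (<<B>> <= M)%VS.
  by apply/span_subvP => _ /mapP[k _ ->]; apply: prim_mem.
have BM : <<B>>%VS = M.
  apply/eqP; rewrite eqEdim sBM (eqnP freeB) size_tuple; exact: dim_bose_mesner.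
rewrite -BM in TM; exists (fun k => coord B k T); rewrite {1}(coord_span TM).
by apply: eq_bigr => k _; rewrite BE.
Qed.

End PrimitiveIdempotents.

(** * The dual Bose-Mesner algebra *)

Section DualBoseMesner.
Variables (C : numClosedFieldType) (X : finType) (e : rel X) (D : nat).
Hypotheses (e_sym : symmetric e) (e_conn : gconnected e).
Hypotheses (e_diam : diameter e = D) (e_dr : distance_regular e).
Local Notation Mat := 'M[C]_#|X|.
Variables (E : 'I_D.+1 -> Mat) (x : X).
Hypotheses (E_prim : primitive_idempotents e E) (E_Qpoly : Q_polynomial E).
Local Notation Es := (fun k : 'I_D.+1 => dual_idempotent C e x k).
Let resE := prim_resolution e_sym e_conn e_diam e_dr E_prim.

(** For [T = E i] this is the dual distance matrix with respect to [x] without its usual factor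
    [#|X|]; the entrywise product then becomes the matrix product exactly. *)
Definition dual_mx (T : Mat) : Mat := diag_mx (row (enum_rank x) T).

Lemma dual_mx_sum (I : finType) (c : I -> C) (T : I -> Mat) :
  dual_mx (\sum_i c i *: T i) = \sum_i c i *: dual_mx (T i).
Proof.
rewrite /dual_mx linear_sum linear_sum; apply: eq_bigr => i _.
by rewrite linearZ linearZ.
Qed.

Lemma dual_mxM S T : dual_mx S *m dual_mx T = dual_mx (map2_mx *%R S T).
Proof.
rewrite /dual_mx mulmx_diag; congr diag_mx.
by apply/rowP => a; rewrite !mxE.
Qed.

Lemma dual_idempotentE (k : nat) :
  dual_idempotent C e x k = dual_mx (distance_mx C e k).
Proof.
apply/matrixP => a b; rewrite !mxE enum_rankK.
by have [->|ab] := eqVneq a b; rewrite ?mulr1n ?mulr0n.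
Qed.

Lemma dual_resolution : resolution Es.
Proof.
split.
- by move=> k; rewrite dual_idempotentE tr_diag_mx.
- by move=> k; apply/matrixP => a b; rewrite !mxE conjC_nat.
- move=> k l; rewrite !dual_idempotentE dual_mxM.
  have -> : map2_mx *%R (distance_mx C e k) (distance_mx C e l) =
      (k == l)%:R *: distance_mx C e k.
    by apply/matrixP => a b; rewrite !mxE -val_eqE; do 3 case: eqP; rewrite ?mulr1 ?mulr0 //=; lia.
  by rewrite /dual_mx linearZ linearZ /= -/(dual_mx _); case: eqP; rewrite ?scale1r ?scale0r.
apply/matrixP => a b; rewrite summxE mxE.
under eq_bigr => k _ do rewrite mxE -mulnb natrM.
by rewrite (sum_gdist e_diam (fun=> (a == b)%:R)).
Qed.

Variable o : 'I_D.+1.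
Hypothesis o1 : o = 1%N :> nat.

(** The Krein parameters give the dual matrices a recurrence in [dual_mx (E o)], and these matrices
    span the dual idempotents. *)
Lemma dual_prim_stable (U : {vspace 'cV[C]_#|X|}) :
  stable (dual_mx (E o)) U -> forall k, stable (Es k) U.
Proof.
move=> oU k; have [c ->] : exists c, Es k = \sum_i c i *: dual_mx (E i).
  have [c cE] := bose_mesner_prim e_sym e_conn e_diam e_dr E_prim (distance_mx_mem C e k).
  by exists c; rewrite dual_idempotentE cE dual_mx_sum.
apply: stable_sum => i _; apply: stableZ; move: i.
have [E0 [q [qE qP]]] := E_Qpoly.
have X0 : #|X|%:R != 0 :> C.
  by rewrite pnatr_eq0 -lt0n; apply/card_gt0P; exists x.
apply: (@stable_recurrence _ _ U D (fun i => dual_mx (E i))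
  (fun h i => (#|X|%:R)^-1 * q h o i) o) => //.
- rewrite E0; have -> : dual_mx (const_mx (#|X|%:R)^-1) = (#|X|%:R)^-1 *: 1%:M.
    apply/matrixP => a b; rewrite !mxE; case: eqP; by rewrite ?mulr1 ?mulr0.
  by apply: stableZ => v; rewrite mul1mx.
- move=> i; rewrite dual_mxM qE scaler_sumr -dual_mx_sum; congr dual_mx.
  by apply: eq_bigr => h _; rewrite scalerA.
- move=> i h ih; have [q0 _] := qP h o i.
  by rewrite q0 ?mulr0 ?scale0r // o1; apply/orP; left; lia.
move=> i h ih; left; have [_ qn0] := qP h o i.
by rewrite mulf_neq0 ?invr_eq0 // qn0 // o1 ih; apply/orP; left; lia.
Qed.

Lemma dual_prim_diag : exists ph, dual_mx (E o) = \sum_k ph k *: Es k.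
Proof.
have /mem_bose_mesner[c ->] := prim_mem E_prim o; exists c.
by rewrite dual_mx_sum; apply: eq_bigr => k _; rewrite dual_idempotentE.
Qed.

(* The squared Frobenius norm of the product is q^1_{kl} E_1(x, x) / |X|. *)
Lemma dual_prim_tridiagonal (k l : 'I_D.+1) :
  (k.+1 < l)%N || (l.+1 < k)%N -> E k *m dual_mx (E o) *m E l = 0.
Proof.
move=> kl; have [_ [q [qE qP]]] := E_Qpoly.
pose v := row (enum_rank x) (E o); have vreal : map_mx Num.conj v = v.
  by rewrite /v -[in RHS](res_real resE o); apply/rowP => a; rewrite !mxE.
have vE h : v *m E h = if o == h then v else 0.
  by rewrite /v -row_mul (res_mul resE); case: eqP => // _; rewrite row0.
have q0 : q o k l = 0.
  by have [q0 _] := qP o k l; apply: q0; rewrite o1; lia.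
apply: trace_adjoint_eq0.
rewrite !map_mxM !trmx_mul map_diag_mx vreal tr_diag_mx !(res_real resE) !(res_sym resE).
rewrite !mulmxA -(mulmxA _ (E l) (E l)) (res_mul resE) eqxx.
rewrite mxtrace_mulC !mulmxA (res_mul resE) eqxx.
(* The trace becomes a quadratic form in the entrywise product, to which the Krein expansion
   applies. *)
have -> : \tr (E k *m diag_mx v *m E l *m diag_mx v)
    = (v *m map2_mx *%R (E k) (E l) *m v^T) 0 0.
  rewrite mxE; under [RHS]eq_bigr => b _ do rewrite mxE mulr_suml.
  rewrite exchange_big /=; apply: eq_bigr => a _.
  rewrite mul_mx_diag mxE [X in X * _]mxE mulr_suml; apply: eq_bigr => b _.
  have sl : E l b a = E l a b by rewrite -[in LHS](res_sym resE l) mxE.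
  by rewrite mul_mx_diag !mxE sl; ring.
rewrite qE -scalemxAr -scalemxAl mxE mulmx_sumr mulmx_suml.
(* By [vE] only [h = o] could contribute, and its coefficient is [q o k l = 0]. *)
rewrite summxE big1 ?mulr0 // => h _; rewrite -scalemxAr -scalemxAl mxE vE.
by case: eqP => [<-|_]; rewrite ?q0 ?mul0r // mul0mx mxE mulr0.
Qed.

(** Distances from [x] to adjacent vertices differ by at most one. *)
Lemma distance_mx_tridiagonal (k l : 'I_D.+1) :
  (k.+1 < l)%N || (l.+1 < k)%N ->
  Es k *m distance_mx C e o *m Es l = 0.
Proof.
move=> kl; rewrite /= !dual_idempotentE /dual_mx; apply/matrixP => a b.
rewrite mul_mx_diag mul_diag_mx !mxE enum_rankK o1.
have := gdist_triangle e_conn x (enum_val a) (enum_val b).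
have := gdist_triangle e_conn x (enum_val b) (enum_val a).
rewrite (gdist_sym e_sym e_conn (enum_val b)).
do 3 case: eqP; rewrite ?mulr0 ?mul0r //; lia.
Qed.

Lemma split_proj_trmx_Qpoly mu nu i j :
  (split_proj Es E mu nu i j)^T
    = split_proj Es E (opposite mu) (opposite nu) (rev_ord i) (rev_ord j).
Proof.
have [th thE] := bose_mesner_prim e_sym e_conn e_diam e_dr E_prim (distance_mx_mem C e o).
have [ph phE] := dual_prim_diag.
apply: (tridiagonal_split_proj_trmx dual_resolution resE thE phE).
- exact: distance_mx_tridiagonal.
- exact: dual_prim_tridiagonal.
- move=> U oU k.
  exact: (bose_mesner_stable e_conn e_diam e_dr o1 (prim_mem E_prim k) oU).
- exact: dual_prim_stable.
Qed.

End DualBoseMesner.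

Theorem theorem4p7 (R : realType) (X : finType) (e : rel X) (D : nat)
    (e_sym : symmetric e) (e_irr : irreflexive e) (e_conn : gconnected e)
    (e_diam : diameter e = D) (D_ge3 : (3 <= D)%N)
    (e_dr : distance_regular e)
    (E : 'I_D.+1 -> 'M[complex R]_#|X|)
    (E_prim : primitive_idempotents e E) (E_Qpoly : Q_polynomial E) (x : X) :
  let Es := fun k : 'I_D.+1 => dual_idempotent (complex R) e x k in
  [/\ forall (mu nu : direction) (i j : 'I_D.+1),
        map_mx Num.conj (split_proj Es E mu nu i j) = split_proj Es E mu nu i j,
      forall i j : 'I_D.+1,
        (split_proj Es E Down Down i j)^T
          = split_proj Es E Up Up (rev_ord i) (rev_ord j)
    & forall i j : 'I_D.+1,
        (split_proj Es E Down Up i j)^T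
          = split_proj Es E Up Down (rev_ord i) (rev_ord j)].
Proof.
have D_gt0 : (1 < D.+1)%N by lia.
have tr := @split_proj_trmx_Qpoly (complex R) X e D e_sym e_conn e_diam e_dr E x
  E_prim E_Qpoly (Ordinal D_gt0) erefl.
move=> Es; split=> [mu nu i j|i j|i j]; [|exact: tr|exact: tr].
apply: split_proj_conj; first exact: (dual_resolution _ e_diam x).
exact: (prim_resolution e_sym e_conn e_diam e_dr E_prim).
Qed.
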